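(* Let $M$ be a smooth manifold of dimension $n\ge 3$, and let $g(t)$, $t\in I$ ($I$ an interval), be a smooth family of Riemannian metrics on $M$ solving the Ricci flow $\frac{\partial g_{ij}}{\partial t}=-2R_{ij}$, whose scalar curvature $R$ is nowhere zero. Let $R_{ijkl}$, $W_{ijkl}$ and $L_{ijkl}$ denote the components, in a fixed (time-independent) coordinate system, of the Riemann curvature tensor, the Weyl conformal tensor and the conharmonic curvature tensor of $g(t)$. Then $$\frac{\partial}{\partial t}\left(\frac{W_{ijkl}-L_{ijkl}}{R}\right)=\frac{2}{n-1}\left(L_{ijkl}-R_{ijkl}\right).$$
   Context: $R_{ijkl}$ is the $(0,4)$ Riemann curvature tensor, $R_{ij}$ the Ricci tensor and $R$ the scalar curvature of $g$; the index convention used here is that $R_{il}=g^{jk}R_{ijkl}$, so that a metric of constant sectional curvature $K$ has $R_{ijkl}=K(g_{il}g_{jk}-g_{ik}g_{jl})$. The conharmonic curvature tensor is $$L_{ijkl}=R_{ijkl}-\frac{1}{n-2}\left[g_{jk}R_{il}+g_{il}R_{jk}-g_{ik}R_{jl}-g_{jl}R_{ik}\right].$$ The Weyl conformal tensor is $$W_{ijkl}=R_{ijkl}-\frac{1}{n-2}\left(g_{jk}R_{il}-g_{ik}R_{jl}+g_{il}R_{jk}-g_{jl}R_{ik}\right)+\frac{R}{(n-1)(n-2)}\left(g_{il}g_{jk}-g_{jl}g_{ik}\right).$$ *)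

(* Defs.v *)
(* World: MathComp-Analysis; the real line is an arbitrary [R : realType] and
   R^n is ['rV[R]_n]. *)
From HB Require Import structures.
From mathcomp Require Import all_boot all_order all_algebra.
From mathcomp Require Import all_classical all_reals all_analysis.

Set Implicit Arguments.
Unset Strict Implicit.
Unset Printing Implicit Defensive.

Import Order.TTheory GRing.Theory Num.Theory.
Import numFieldNormedType.Exports.

Local Open Scope classical_set_scope.
Local Open Scope ring_scope.

Definition partial (R : realType) (n : nat) (i : 'I_n) (f : 'rV[R]_n -> R)
  (x : 'rV[R]_n) : R := 'D_(delta_mx 0 i) f x.

(* Derivative at t of a function on the interval I: the difference quotient is
   taken over s in I, so it is one-sided at an end point that belongs to I and
   the usual derivative at interior points. *)
Definition has_derive_in (R : realType) (I : interval R) (f : R -> R)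
  (t l : R) : Prop :=
  (f s - f t) / (s - t) @[s --> within [set` I] t^'] --> l.

Definition derive_in (R : realType) (I : interval R) (f : R -> R) (t : R) : R :=
  lim ((f s - f t) / (s - t) @[s --> within [set` I] t^']).

Definition iter_partial (R : realType) (n : nat) (w : seq 'I_n)
  (f : 'rV[R]_n -> R) : 'rV[R]_n -> R := foldr (@partial R n) f w.

(* C^infinity on a set U, meant for open U: all iterated partial derivatives
   exist and are continuous on U. *)
Definition smooth_on (R : realType) (n : nat) (U : set 'rV[R]_n)
  (f : 'rV[R]_n -> R) : Prop :=
  forall w : seq 'I_n,
    {within U, continuous (iter_partial w f)} /\
    forall x, U x -> forall i : 'I_n,
      derivable (iter_partial w f) x (delta_mx 0 i).

Definition smooth_map_on (R : realType) (n m : nat) (U : set 'rV[R]_n)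
  (f : 'rV[R]_n -> 'rV[R]_m) : Prop :=
  forall k : 'I_m, smooth_on U (fun x => f x 0 k).

(* Mixed space-time derivatives: [None] stands for d/dt, [Some i] for d/dx^i. *)
Definition partial_st (R : realType) (n : nat) (I : interval R)
  (o : option 'I_n) (f : R -> 'rV[R]_n -> R) (t : R) (x : 'rV[R]_n) : R :=
  if o is Some i then partial i (f t) x else derive_in I (f ^~ x) t.

Definition iter_partial_st (R : realType) (n : nat) (I : interval R)
  (w : seq (option 'I_n)) (f : R -> 'rV[R]_n -> R) : R -> 'rV[R]_n -> R :=
  foldr (@partial_st R n I) f w.

(* C^infinity on I x U jointly in (t, x), for an interval I and an open U. *)
Definition smooth_st (R : realType) (n : nat) (I : interval R)
  (U : set 'rV[R]_n) (f : R -> 'rV[R]_n -> R) : Prop :=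
  forall w : seq (option 'I_n),
    {within [set` I] `*` U, continuous
       (fun p : R * 'rV[R]_n => iter_partial_st I w f p.1 p.2)} /\
    forall t x, t \in I -> U x ->
      (exists l, has_derive_in I (fun s => iter_partial_st I w f s x) t l) /\
      (forall i : 'I_n,
         derivable (iter_partial_st I w f t) x (delta_mx 0 i)).

(* Both maps are total functions; their values off [chart_dom] and [chart_img]
   are irrelevant. *)
Record chart (R : realType) (n : nat) (M : topologicalType) := Chart {
  chart_dom : set M;
  chart_img : set 'rV[R]_n;
  chart_map : M -> 'rV[R]_n;
  chart_inv : 'rV[R]_n -> M;
  chart_dom_open : open chart_dom;
  chart_img_open : open chart_img;
  chart_map_img : forall p, chart_dom p -> chart_img (chart_map p);
  chart_inv_dom : forall x, chart_img x -> chart_dom (chart_inv x);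
  chart_mapK : forall p, chart_dom p -> chart_inv (chart_map p) = p;
  chart_invK : forall x, chart_img x -> chart_map (chart_inv x) = x;
  chart_map_continuous : {within chart_dom, continuous chart_map};
  chart_inv_continuous : {within chart_img, continuous chart_inv}
}.

(* The part of the image of [a] on which the change of coordinates from [a] to
   [b] is defined. *)
Definition overlap (R : realType) (n : nat) (M : topologicalType)
  (a b : chart R n M) : set 'rV[R]_n :=
  [set x | chart_img a x /\ chart_dom b (chart_inv a x)].

Definition transition (R : realType) (n : nat) (M : topologicalType)
  (a b : chart R n M) : 'rV[R]_n -> 'rV[R]_n := chart_map b \o chart_inv a.

Definition compatible (R : realType) (n : nat) (M : topologicalType)
  (a b : chart R n M) : Prop :=
  smooth_map_on (overlap a b) (transition a b) /\
  smooth_map_on (overlap b a) (transition b a).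

(* The atlas is maximal, so that its charts are exactly the local coordinate
   systems of the manifold. *)
Record smoothManifold (R : realType) (n : nat) := SmoothManifold {
  manifold_space :> topologicalType;
  atlas : set (chart R n manifold_space);
  manifold_hausdorff : hausdorff_space manifold_space;
  manifold_second_countable : @second_countable manifold_space;
  atlas_cover : forall p : manifold_space, exists2 a, atlas a & chart_dom a p;
  atlas_compatible : forall a b, atlas a -> atlas b -> compatible a b;
  atlas_maximal : forall a, (forall b, atlas b -> compatible a b) -> atlas a
}.

(* A covariant 2-tensor field is given by its components in every coordinate
   system, as functions of the coordinates: [h a x i j] is h_ij in the chart [a]
   at the point with coordinates [x]. *)
Definition components2 (R : realType) (n : nat) (M : smoothManifold R n) : Type :=
  chart R n M -> 'rV[R]_n -> 'M[R]_n.

(* The transformation law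
     h^a_ij = sum_kl (d y^k / d x^i) (d y^l / d x^j) h^b_kl
   for y the change of coordinates from [a] to [b]; with row vectors,
   ['J y x i k] is the derivative of y^k with respect to x^i. *)
Definition is_tensor2 (R : realType) (n : nat) (M : smoothManifold R n)
  (h : components2 M) : Prop :=
  forall a b, atlas a -> atlas b -> forall x, overlap a b x ->
    h a x = 'J (transition a b) x *m h b (transition a b x)
              *m ('J (transition a b) x)^T.

Definition riemannian_metric (R : realType) (n : nat) (M : smoothManifold R n)
  (h : components2 M) : Prop :=
  is_tensor2 h /\
  forall a, atlas a ->
    (forall i j, smooth_on (chart_img a) (fun x => h a x i j)) /\
    (forall x, chart_img a x ->
       (h a x)^T = h a x /\
       forall v : 'rV[R]_n, v != 0 -> 0 < (v *m h a x *m v^T) 0 0).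

Definition smooth_metric_family (R : realType) (n : nat)
  (M : smoothManifold R n) (I : interval R) (g : R -> components2 M) : Prop :=
  (forall t, t \in I -> riemannian_metric (g t)) /\
  (forall a, atlas a -> forall i j,
     smooth_st I (chart_img a) (fun t x => g t a x i j)).

(* In the curvature definitions, [g] is the matrix of components of a metric in
   one coordinate system, as a function of the coordinates. *)
Section Curvature.
Context (R : realType) (n : nat) (g : 'rV[R]_n -> 'M[R]_n).

Definition ginv (x : 'rV[R]_n) : 'M[R]_n := invmx (g x).

(* [christoffel k i j] is Gamma^k_ij. *)
Definition christoffel (k i j : 'I_n) (x : 'rV[R]_n) : R :=
  2^-1 * \sum_l ginv x k l *
    (partial i (fun y => g y j l) x + partial j (fun y => g y i l) x
     - partial l (fun y => g y i j) x).

(* [riemann13 i j k l] is R_ijk^l, where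
     nabla_i nabla_j d_k - nabla_j nabla_i d_k = sum_l R_ijk^l d_l. *)
Definition riemann13 (i j k l : 'I_n) (x : 'rV[R]_n) : R :=
  partial i (christoffel l j k) x - partial j (christoffel l i k) x
  + \sum_p (christoffel p j k x * christoffel l i p x
            - christoffel p i k x * christoffel l j p x).

(* The last index is the lowered one; for constant sectional curvature K this
   gives R_ijkl = K (g_il g_jk - g_ik g_jl). *)
Definition riemann (x : 'rV[R]_n) (i j k l : 'I_n) : R :=
  \sum_m g x l m * riemann13 i j k m x.

Definition ricci (x : 'rV[R]_n) (i l : 'I_n) : R :=
  \sum_j \sum_k ginv x j k * riemann x i j k l.

Definition scalar_curvature (x : 'rV[R]_n) : R :=
  \sum_i \sum_l ginv x i l * ricci x i l.

Definition conharmonic (x : 'rV[R]_n) (i j k l : 'I_n) : R :=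
  riemann x i j k l
  - (n%:R - 2)^-1 *
    (g x j k * ricci x i l + g x i l * ricci x j k
     - g x i k * ricci x j l - g x j l * ricci x i k).

Definition weyl (x : 'rV[R]_n) (i j k l : 'I_n) : R :=
  riemann x i j k l
  - (n%:R - 2)^-1 *
    (g x j k * ricci x i l - g x i k * ricci x j l
     + g x i l * ricci x j k - g x j l * ricci x i k)
  + scalar_curvature x / ((n%:R - 1) * (n%:R - 2)) *
    (g x i l * g x j k - g x j l * g x i k).

End Curvature.

Definition ricci_flow (R : realType) (n : nat) (M : smoothManifold R n)
  (I : interval R) (g : R -> components2 M) : Prop :=
  forall a, atlas a -> forall t x, t \in I -> chart_img a x -> forall i j,
    has_derive_in I (fun s => g s a x i j) t (- 2 * ricci (g t a) x i j).

(* Main.v *)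
Require Import Defs.
From mathcomp Require Import all_boot all_order all_algebra.
From mathcomp Require Import all_classical all_reals all_analysis.
From mathcomp Require Import ring.

Import Order.TTheory GRing.Theory Num.Theory.
Import numFieldNormedType.Exports.

Local Open Scope classical_set_scope.
Local Open Scope ring_scope.

(** The tensors [weyl] and [conharmonic] differ only by the scalar curvature
    term of the Weyl tensor, so that where the scalar curvature does not vanish
    [[
      (W_ijkl - L_ijkl) / R = (g_il g_jk - g_jl g_ik) / ((n-1)(n-2)).
    ]]
    No curvature is left on the right-hand side ([weyl_sub_conharmonic_div]):
    its time derivative is given by the product rule and the flow equation
    alone, without the evolution equations of the curvature tensors. Replacing
    each derivative of g_ij by -2 R_ij produces
    [[
      -2 (g_jk R_il + g_il R_jk - g_ik R_jl - g_jl R_ik) / ((n-1)(n-2)),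
    ]]
    and the bracket over n-2 is exactly R_ijkl - L_ijkl.

    The rules of calculus below are proved for [has_derive_in], where the
    difference quotient is restricted to an interval and may be one-sided. *)

Section HasDeriveIn.
Context {R : realType} {I : interval R}.
Implicit Types (t l m c : R).

(** The value at [t] itself enters every difference quotient, hence the
    hypothesis that [t] lies in [I]. *)
Lemma eq_has_derive_in {f g : R -> R} {t l} : t \in I -> {in I, f =1 g} ->
  has_derive_in I f t l -> has_derive_in I g t l.
Proof.
move=> tI fg fl; apply: cvg_trans fl; apply: fmap_within_eq => s.
by rewrite inE => sI; rewrite !fg.
Qed.

(** A limit of the difference quotient forces continuity within [I], because
    [f s = f t + (f s - f t) / (s - t) * (s - t)] for [s] different from [t]. *)
Lemma has_derive_in_cvg {f : R -> R} {t l} : has_derive_in I f t l ->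
  f s @[s --> within [set` I] t^'] --> f t.
Proof.
move=> fl.
have st : s - t @[s --> within [set` I] t^'] --> 0.
  rewrite -(subrr t); apply: cvgB; last exact: cvg_cst.
  by apply: (@cvg_within_filter _ _ id); exact: nbhs_dnbhs.
have neq_t : \forall s \near within [set` I] t^', s != t.
  exact: cvg_within (nbhs_dnbhs_neq t).
rewrite -[X in _ --> X]addr0 -(mulr0 l).
apply: (cvg_trans (near_eq_cvg _) (cvgD (cvg_cst (f t)) (cvgM fl st))).
apply: filterS neq_t => s neq_st.
by rewrite !fctE /= mulfVK ?subr_eq0// addrC subrK.
Qed.

Lemma has_derive_inB {f g : R -> R} {t l m} :
  has_derive_in I f t l -> has_derive_in I g t m ->
  has_derive_in I (fun s => f s - g s) t (l - m).
Proof.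
move=> fl gm; apply: (cvg_trans (near_eq_cvg _) (cvgB fl gm)).
by apply: filterE => s; rewrite !fctE /=; ring.
Qed.

Lemma has_derive_inM {f g : R -> R} {t l m} :
  has_derive_in I f t l -> has_derive_in I g t m ->
  has_derive_in I (fun s => f s * g s) t (l * g t + f t * m).
Proof.
move=> fl gm.
have gt := has_derive_in_cvg gm.
apply: (cvg_trans (near_eq_cvg _) (cvgD (cvgM fl gt) (cvgM (cvg_cst _) gm))).
by apply: filterE => s; rewrite !fctE /=; ring.
Qed.

Lemma has_derive_inZ c {f : R -> R} {t l} : has_derive_in I f t l ->
  has_derive_in I (fun s => c * f s) t (c * l).
Proof.
move=> fl; apply: (cvg_trans (near_eq_cvg _) (cvgM (cvg_cst c) fl)).
by apply: filterE => s /=; ring.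
Qed.

End HasDeriveIn.

Lemma weyl_sub_conharmonic_div (R : realType) (n : nat)
  (g : 'rV[R]_n -> 'M[R]_n) (x : 'rV[R]_n) (i j k l : 'I_n) :
  scalar_curvature g x != 0 ->
  (weyl g x i j k l - conharmonic g x i j k l) / scalar_curvature g x =
  ((n%:R - 1) * (n%:R - 2))^-1 *
    (g x i l * g x j k - g x j l * g x i k).
Proof.
move=> S0; rewrite /weyl /conharmonic.
apply: (mulIf S0); rewrite divfK//; ring.
Qed.

Theorem theorem2 (R : realType) (n : nat) (hn : (3 <= n)%N)
  (M : smoothManifold R n) (I : interval R) (g : R -> components2 M)
  (hg : smooth_metric_family I g)
  (hflow : ricci_flow I g)
  (hscal : forall a, atlas a -> forall t x, t \in I -> chart_img a x ->
     scalar_curvature (g t a) x <> 0)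
  (a : chart R n M) (ha : atlas a) (t : R) (ht : t \in I)
  (x : 'rV[R]_n) (hx : chart_img a x) (i j k l : 'I_n) :
  has_derive_in I
    (fun s => (weyl (g s a) x i j k l - conharmonic (g s a) x i j k l)
              / scalar_curvature (g s a) x)
    t
    (2 / (n%:R - 1)
     * (conharmonic (g t a) x i j k l - riemann (g t a) x i j k l)).
Proof.
apply: (@eq_has_derive_in _ _ (fun s => ((n%:R - 1) * (n%:R - 2))^-1 *
    (g s a x i l * g s a x j k - g s a x j l * g s a x i k))) => //.
  move=> s sI; rewrite weyl_sub_conharmonic_div//.
  by apply/eqP; exact: hscal.
have dg p q := hflow a ha t x ht hx p q.
have := has_derive_inZ ((n%:R - 1) * (n%:R - 2))^-1
  (has_derive_inB (has_derive_inM (dg i l) (dg j k))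
                  (has_derive_inM (dg j l) (dg i k))).
congr (has_derive_in _ _ _ _).
rewrite /conharmonic invfM; ring.
Qed.
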